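(* Let $G=(S\cup K,E)$ be a split graph on $n$ vertices, where $S$ is an independent set and $K$ is a clique of $G$, and assume $K$ is a maximum clique, i.e. $\omega(G)=|K|$. Then $$Tr(G)+Tr(\overline{G})=\begin{cases} n+2 & \text{if, in } G, \text{ every vertex of } K \text{ has a neighbour in } S,\\ n+1 & \text{otherwise.}\end{cases}$$
   Context: All graphs are finite and simple; $\overline{G}$ is the complement of $G$. For disjoint $A,B\subseteq V$, $A$ dominates $B$ if every vertex of $B$ is adjacent to at least one vertex of $A$. A transitive $k$-partition of $G=(V,E)$ is a partition $\{V_1,\dots,V_k\}$ of $V$ into $k$ nonempty parts such that $V_i$ dominates $V_j$ for all $1\le i<j\le k$; the transitivity $Tr(G)$ is the maximum such $k$. A split graph is a graph whose vertex set can be partitioned into an independent set and a clique; $\omega(G)$ is the size of a maximum clique. *)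

(* Defs.v *)
(* A finite simple graph is a symmetric irreflexive relation
   [e] on a finType [T]. *)
From mathcomp Require Import all_boot.

Set Implicit Arguments.
Unset Strict Implicit.
Unset Printing Implicit Defensive.

Section Graphs.

Variables (T : finType) (e : rel T).

Definition compl_graph : rel T := [rel x y | (x != y) && ~~ e x y].

Definition independent (A : {set T}) : bool :=
  [forall x in A, forall y in A, ~~ e x y].

Definition clique (A : {set T}) : bool :=
  [forall x in A, forall y in A, (x != y) ==> e x y].

Definition clique_number : nat := \max_(A : {set T} | clique A) #|A|.

Definition dominates (A B : {set T}) : bool :=
  [forall y in B, exists x in A, e x y].

(* Parts are indexed from 0.  [partition] forces them to be nonempty;
   injectivity is needed because a repeated part would vanish in the image
   set. *)
Definition transitive_partition (k : nat) (V : {ffun 'I_k -> {set T}}) : bool :=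
  [&& injectiveb V,
      partition [set V i | i : 'I_k] [set: T] &
      [forall i : 'I_k, forall j : 'I_k, (i < j) ==> dominates (V i) (V j)]].

Definition has_transitive_partition (k : nat) : bool :=
  [exists V : {ffun 'I_k -> {set T}}, transitive_partition V].

(* The range k <= #|T| loses nothing: see [has_transitive_partition_leq]. *)
Definition transitivity : nat :=
  \max_(k < #|T|.+1 | has_transitive_partition k) k.

Lemma has_transitive_partition_leq (k : nat) :
  has_transitive_partition k -> k <= #|T|.
Proof.
case/existsP=> V /and3P[/injectiveP injV partV _].
have cardV : #|[set V i | i : 'I_k]| = k by rewrite card_imset // card_ord.
rewrite -{1}cardV -cardsT (card_partition partV) -sum1_card.
apply: leq_sum => A AV; rewrite card_gt0; apply: contraTneq AV => ->.
by case/and3P: partV.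
Qed.

End Graphs.

(* Main.v *)
Require Import Defs.
From mathcomp Require Import all_boot.

(** Call [(S, K)] saturated when [S] is nonempty and independent, [K] is its
    complement and a clique, and every vertex of [K] has a neighbour in [S].
    Then the transitivity is [#|K| + 1]: of two parts avoiding [K] the first
    could not dominate the second, so at most one part avoids [K]; conversely
    [S] followed by the singletons of [K] is a transitive partition.
    Maximality of [K] says exactly that [(K, S)] is saturated in the
    complement.  In [G] either [(S, K)] is saturated, or some [v] in [K] has no
    neighbour in [S] and moving [v] from [K] to [S] gives a saturated pair. *)

(** A transitive partition amounts to a labelling of the vertices: fibres cover [T] and are disjoint
    automatically, and surjectivity makes them nonempty and pairwise distinct, so only domination
    remains to be checked. *)
Lemma transitive_partition_fibers (T : finType) (e : rel T) (k : nat)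
    (f : T -> 'I_k) :
    (forall i, exists x, f x = i) ->
    (forall (i : 'I_k) y, i < f y -> exists2 x, f x = i & e x y) ->
  has_transitive_partition e k.
Proof.
move=> f_surj f_dom; apply/existsP.
exists [ffun i => [set x | f x == i]]; apply/and3P; split.
- apply/injectiveP => i j; rewrite !ffunE => /setP eq_ij.
  have [x fx] := f_surj i.
  by have := eq_ij x; rewrite !inE fx eqxx => /esym/eqP.
- apply/and3P; split.
  + rewrite eqEsubset subsetT; apply/subsetP => x _.
    apply/bigcupP; exists [set y | f y == f x]; last by rewrite inE.
    by apply/imsetP; exists (f x); rewrite ?ffunE.
  + apply/trivIsetP => _ _ /imsetP[i _ ->] /imsetP[j _ ->].
    rewrite !ffunE => neq_ij; rewrite -setI_eq0; apply/eqP/setP => x.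
    rewrite !inE; apply/negP => /andP[/eqP fi /eqP fj].
    by rewrite -fi -fj eqxx in neq_ij.
  + apply/negP => /imsetP[i _]; rewrite ffunE => /setP/(_ _) E.
    by have [x fx] := f_surj i; have := E x; rewrite !inE fx eqxx.
- apply/forallP => i; apply/forallP => j; apply/implyP => lt_ij.
  apply/forallP => y; apply/implyP; rewrite !ffunE inE => /eqP fy.
  have [|x fx exy] := f_dom i y; first by rewrite fy.
  by apply/existsP; exists x; rewrite inE fx eqxx.
Qed.

Lemma leq_transitivity (T : finType) (e : rel T) (k : nat) :
  has_transitive_partition e k -> k <= transitivity e.
Proof.
move=> ek; have lt_kT : k < #|T|.+1.
  exact: has_transitive_partition_leq ek.
exact: (@leq_bigmax_cond _ _ (fun k : 'I_#|T|.+1 => k : nat) (Ordinal lt_kT)).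
Qed.

Lemma has_transitive_partition_split_leq (T : finType) (e : rel T)
    (S K : {set T}) (k : nat) :
    S :|: K = [set: T] -> independent e S ->
  has_transitive_partition e k -> k <= #|K|.+1.
Proof.
move=> SKT Sind /existsP[V /and3P[/injectiveP V_inj Vpart /forallP Vdom]].
case/and3P: Vpart => _ /trivIsetP Vtriv V0.
have avoidS (i : 'I_k) : V i :&: K = set0 -> V i \subset S.
  move=> ViK; apply/subsetP => x xVi.
  have : x \in S :|: K by rewrite SKT inE.
  rewrite inE => /orP[//|xK].
  by have := in_set0 x; rewrite -ViK inE xVi xK.
have not_dom (i j : 'I_k) : V i :&: K = set0 -> V j :&: K = set0 -> ~~ (i < j).
  move=> /avoidS/subsetP Vi /avoidS/subsetP Vj; apply/negP => lt_ij.
  have [E|[y yVj]] := set_0Vmem (V j).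
    by case/negP: V0; rewrite -E; apply: imset_f.
  have /forallP/(_ j)/implyP/(_ lt_ij)/forall_inP/(_ y yVj) := Vdom i.
  case/exists_inP=> x xVi exy.
  have /forall_inP/(_ x (Vi _ xVi))/forall_inP/(_ y (Vj _ yVj)) := Sind.
  by rewrite exy.
(* Each part is represented by one of its vertices in [K], or by [None] if it avoids [K]. Parts
   sharing a representative in [K] meet, hence coincide; two parts represented by [None] coincide by
   [not_dom]. So [k] is at most the number of possible values, [#|K| + 1]. *)
pose r i := [pick x in V i :&: K].
have r_inj : injective r.
  move=> i j; rewrite /r.
  case: pickP => [x|Pi]; case: pickP => [y|Pj] //.
    rewrite !inE => /andP[yVj _] /andP[xVi _] [xy]; rewrite -xy in yVj.
    apply: contraTeq (xVi) => neq_ij.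
    have dij : [disjoint V i & V j].
      by apply: Vtriv; rewrite ?imset_f // (inj_eq V_inj).
    by rewrite (disjointFl dij yVj).
  have ViK : V i :&: K = set0 by apply/setP => x; rewrite Pi inE.
  have VjK : V j :&: K = set0 by apply/setP => x; rewrite Pj inE.
  move=> _; apply: ord_inj; apply/eqP; rewrite eqn_leq.
  by rewrite [i <= j]leqNgt [j <= i]leqNgt !not_dom.
rewrite -[k]card_ord -(card_imset _ r_inj).
apply: leq_trans (_ : #|None |: [set Some x | x in K]| <= _); last first.
  rewrite cardsU1 (card_imset _ Some_inj) -add1n leq_add2r.
  by case: (_ \notin _).
apply/subset_leq_card/subsetP => _ /imsetP[i _ ->].
rewrite /r; case: pickP => [x|_]; last by rewrite !inE.
by rewrite !inE => /andP[_ xK]; rewrite imset_f.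
Qed.

Lemma has_transitive_partition_split (T : finType) (e : rel T)
    (S K : {set T}) :
    S :|: K = [set: T] -> [disjoint S & K] -> S != set0 ->
    clique e K -> {in K, forall x, exists2 y, y \in S & e y x} ->
  has_transitive_partition e #|K|.+1.
Proof.
move=> SKT dSK /set0Pn[s sS] Kcl Kdom.
have notK x : x \in S -> x \notin K.
  by move=> xS; rewrite (disjointFr dSK xS).
(* Label 0 is reserved for [S]; the successor shifts the positions in [enum K] to 1, ..., [#|K|], so
   [inord] never falls back on its default. *)
pose f x : 'I_#|K|.+1 := inord (if x \in K then (index x (enum K)).+1 else 0).
have fK x : x \in K -> f x = (index x (enum K)).+1 :> nat.
  by move=> xK; rewrite /f xK inordK // ltnS cardE index_mem mem_enum.
have fS x : x \notin K -> f x = 0 :> nat.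
  by move=> /negbTE xK; rewrite /f xK inordK.
have fS_wit (i : 'I_#|K|.+1) x : i = 0 :> nat -> x \in S -> f x = i.
  by move=> i0 xS; apply/val_inj; rewrite /= fS ?i0 ?notK.
have fK_wit (i : 'I_#|K|.+1) : 0 < i -> exists2 x, x \in K & f x = i.
  move=> i_gt0; have lt_i : i.-1 < size (enum K).
    by rewrite -cardE prednK // -ltnS.
  (* Here [s] is only the default of [nth]; it is never returned, since [i.-1] is in range. *)
  have xK : nth s (enum K) i.-1 \in K by rewrite -mem_enum mem_nth.
  exists (nth s (enum K) i.-1) => //; apply/val_inj.
  by rewrite /= fK // index_uniq ?enum_uniq // prednK.
apply: (@transitive_partition_fibers _ _ _ f) => [i|i y lt_iy].
  case: (posnP i) => [i0|/fK_wit[x _ fx]]; last by exists x.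
  by exists s; apply: fS_wit.
have yK : y \in K by apply: contraTT lt_iy => /fS ->.
case: (posnP i) => [i0|/fK_wit[x xK fx]].
  by have [x xS exy] := Kdom y yK; exists x; rewrite ?(fS_wit i).
exists x => //.
have /forall_inP/(_ x xK)/forall_inP/(_ y yK)/implyP := Kcl; apply.
by apply: contraTneq lt_iy => <-; rewrite fx ltnn.
Qed.

Lemma transitivity_split (T : finType) (e : rel T) (S K : {set T}) :
    S :|: K = [set: T] -> [disjoint S & K] -> S != set0 ->
    independent e S -> clique e K ->
    {in K, forall x, exists2 y, y \in S & e y x} ->
  transitivity e = #|K|.+1.
Proof.
move=> SKT dSK S0 Sind Kcl Kdom; apply/eqP; rewrite eqn_leq.
apply/andP; split.
  by apply/bigmax_leqP => k; exact: has_transitive_partition_split_leq SKT Sind.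
by apply: leq_transitivity; exact: has_transitive_partition_split Kdom.
Qed.

Theorem theorem4 (T : finType) (e : rel T) (S K : {set T})
    (e_sym : symmetric e) (e_irr : irreflexive e)
    (T_nonempty : 0 < #|T|)
    (S_K_cover : S :|: K = [set: T]) (S_K_disjoint : [disjoint S & K])
    (S_indep : independent e S) (K_clique : clique e K)
    (K_maximum : clique_number e = #|K|) :
  transitivity e + transitivity (compl_graph e) =
    if [forall x in K, exists y in S, e x y] then #|T| + 2 else #|T| + 1.
Proof.
have indepP x y : x \in S -> y \in S -> ~~ e x y.
  by move=> xS yS; have /forall_inP/(_ x xS)/forall_inP/(_ y yS) := S_indep.
have cliqueP x y : x \in K -> y \in K -> x != y -> e x y.
  move=> xK yK.
  by have /forall_inP/(_ x xK)/forall_inP/(_ y yK)/implyP := K_clique.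
have maxK (A : {set T}) : clique e A -> #|A| <= #|K|.
  by move=> Acl; rewrite -K_maximum /clique_number (leq_bigmax_cond _ Acl).
have notK x : x \in S -> x \notin K.
  by move=> xS; rewrite (disjointFr S_K_disjoint xS).
have cardT : #|S| + #|K| = #|T|.
  by rewrite -cardsT -S_K_cover cardsU disjoint_setI0 // cards0 subn0.
(* A single vertex is a clique, so a maximum clique of a nonempty graph is nonempty. In the
   complement [K] is the independent side, which has to be nonempty. *)
have K0 : K != set0.
  have /card_gt0P[x _] := T_nonempty.
  rewrite -card_gt0 -(cards1 x); apply: maxK.
  apply/forall_inP => y /set1P ->; apply/forall_inP => z /set1P ->.
  by rewrite eqxx.
have -> : transitivity (compl_graph e) = #|S|.+1.
  apply: (@transitivity_split _ _ K S) => //.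
  - by rewrite setUC.
  - by rewrite disjoint_sym.
  - apply/forall_inP => x xK; apply/forall_inP => y yK.
    rewrite /compl_graph /= negb_and !negbK.
    by case: (eqVneq x y) => //= neq_xy; rewrite cliqueP.
  - apply/forall_inP => x xS; apply/forall_inP => y yS.
    by apply/implyP => neq_xy; rewrite /compl_graph /= neq_xy indepP.
  - move=> s sS.
    have /exists_inP[y yK Nesy] : [exists y in K, ~~ e y s].
      (* If [s] were adjacent to all of [K], then [s |: K] would be a clique larger than [K]. *)
      rewrite -negb_forall_in; apply/negP => /forall_inP sK.
      have : #|s |: K| <= #|K|.
        apply: maxK; apply/forall_inP => x xsK; apply/forall_inP => y ysK.
        apply/implyP; move: xsK ysK.
        case/setU1P=> [->|xK] /setU1P[->|yK]; rewrite ?eqxx // => neq_xy.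
        + by rewrite e_sym sK.
        + exact: sK.
        + exact: cliqueP.
      by rewrite cardsU1 notK // ltnn.
    exists y => //; rewrite /compl_graph /= Nesy andbT.
    by apply: contraTneq yK => ->; exact: notK.
case: ifPn => [/forall_inP Kdom|].
  rewrite (@transitivity_split _ _ S K) // -?cardT.
  - by rewrite addSn addnS addn2 addnC.
  (* [S] is nonempty because it contains a neighbour of some vertex of [K]. *)
  - have /set0Pn[x xK] := K0; have /exists_inP[y yS _] := Kdom x xK.
    by apply/set0Pn; exists y.
  - by move=> x /Kdom/exists_inP[y yS exy]; exists y; rewrite // e_sym.
rewrite negb_forall_in => /exists_inP[v vK].
rewrite negb_exists_in => /forall_inP Nev.
rewrite (@transitivity_split _ _ (v |: S) (K :\ v)).
(* The summand 1 is read as the truth value of [v \in K], so that [cardsD1] restores [#|K|]; the one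
   remaining unit comes from the complement. *)
- by rewrite -add1n -{1}[1]/(true : nat) -vK -cardsD1 -cardT addnS addn1 addnC.
- rewrite -S_K_cover; apply/setP => x; rewrite !inE.
  by case: (eqVneq x v) => [->|//]; rewrite vK orbT.
- rewrite -setI_eq0; apply/eqP/setP => x; rewrite !inE.
  by case: (eqVneq x v) => //= _; apply/andP => -[/notK/negP].
- by apply/set0Pn; exists v; rewrite setU11.
- apply/forall_inP => x xvS; apply/forall_inP => y; move: xvS.
  case/setU1P=> [->|xS] /setU1P[->|yS].
  + by rewrite e_irr.
  + exact: Nev.
  + by rewrite e_sym Nev.
  + exact: indepP.
- apply/forall_inP => x /setD1P[_ xK]; apply/forall_inP => y /setD1P[_ yK].
  by apply/implyP; exact: cliqueP.
(* The moved vertex [v] alone dominates the rest of the clique. *)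
- move=> x /setD1P[neq_xv xK]; exists v; first by rewrite setU11.
  by rewrite cliqueP // eq_sym.
Qed.
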